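(* There is a constant $C>0$ such that for all $n,d\in\mathbb{N}$ and every proximity parameter $\epsilon\in(0,\tfrac12)$ there exists a $1$-sided error unateness tester for functions $f:[n]^d\to\mathbb{R}$ that makes at most $C\cdot\frac{d\log(\max(d,n))}{\epsilon}$ queries.
   Context: $[n]=\{1,\dots,n\}$. Two points $x,y\in[n]^d$ are neighbours if $\sum_i|x_i-y_i|=1$; $e_i$ denotes the $i$-th standard basis vector. A function $f:[n]^d\to\mathbb{R}$ is unate if each dimension $i\in[d]$ can be assigned a direction up or down such that: if up, $f(x)\le f(x+e_i)$ for all $x$ with $x,x+e_i\in[n]^d$; if down, $f(x)\ge f(x+e_i)$ for all such $x$. It is monotone if all directions can be taken up. The distance between $f,g:[n]^d\to\mathbb{R}$ is the fraction of points $x$ with $f(x)\neq g(x)$; $f$ is $\epsilon$-far from a property if its distance to every function with the property is at least $\epsilon$, and $\epsilon$-close otherwise. A unateness tester is a randomized algorithm that, given $\epsilon$ and oracle (query) access to $f$, accepts with probability at least $2/3$ if $f$ is unate and rejects with probability at least $2/3$ if $f$ is $\epsilon$-far from unate. It has $1$-sided error if it accepts every unate $f$ with probability $1$. Its query complexity is the maximum number of oracle queries it makes. *)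

(* Defs.v *)
From HB Require Import structures.
From mathcomp Require Import all_boot all_order all_algebra.
Set Implicit Arguments. Unset Strict Implicit. Unset Printing Implicit Defensive.
Import Order.TTheory GRing.Theory Num.Theory.
Local Open Scope ring_scope.

(* Points of [n]^d, coordinates 0-indexed: x : 'I_d -> 'I_n. *)
Definition pt (d n : nat) : finType := {ffun 'I_d -> 'I_n}.

Definition succ_at (d n : nat) (i : 'I_d) (x y : pt d n) : bool :=
  (nat_of_ord (y i) == (nat_of_ord (x i)).+1)%N &&
  [forall j : 'I_d, (j != i) ==> (y j == x j)].

Definition unate (R : realFieldType) (d n : nat) (f : pt d n -> R) : Prop :=
  exists dir : 'I_d -> bool,
    forall (i : 'I_d) (x y : pt d n), succ_at i x y ->
      if dir i then f x <= f y else f y <= f x.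

Definition monotone (R : realFieldType) (d n : nat) (f : pt d n -> R) : Prop :=
  forall (i : 'I_d) (x y : pt d n), succ_at i x y -> f x <= f y.

Definition dist (R : realFieldType) (d n : nat) (f g : pt d n -> R) : R :=
  (#|[set x : pt d n | f x != g x]|)%:R / (#|pt d n|)%:R.

Definition eps_far (R : realFieldType) (d n : nat) (f : pt d n -> R) (eps : R)
  : Prop := forall g : pt d n -> R, unate g -> eps <= dist f g.

(* Deterministic adaptive query algorithms (decision trees): either output
   a bit (true = accept) or query a point and continue depending on the
   answer. *)
Inductive dtree (P V : Type) : Type :=
| Leaf of bool
| Query of P & (V -> dtree P V).

Fixpoint run (P V : Type) (t : dtree P V) (f : P -> V) : bool :=
  match t with
  | Leaf b => b
  | Query x k => run (k (f x)) f
  end.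

Inductive depth_le (P V : Type) : dtree P V -> nat -> Prop :=
| depth_leaf b q : depth_le (Leaf P V b) q
| depth_query x k q : (forall v, depth_le (k v) q) ->
                      depth_le (Query x k) q.+1.

(* A randomized algorithm: a (finitely supported) probability distribution
   over deterministic query algorithms. *)
Record rtester (R : realFieldType) (d n : nat) := RTester {
  seed : finType;
  weight : seed -> R;
  alg : seed -> dtree (pt d n) R
}.
Arguments seed {R d n} r.
Arguments weight {R d n} r _.
Arguments alg {R d n} r _.

Definition is_distribution (R : realFieldType) (d n : nat) (T : rtester R d n)
  : Prop :=
  (forall s, 0 <= weight T s) /\ \sum_(s : seed T) weight T s = 1.

Definition prob_accept (R : realFieldType) (d n : nat) (T : rtester R d n)
  (f : pt d n -> R) : R :=
  \sum_(s : seed T | run (alg T s) f) weight T s.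

Definition query_complexity_le (R : realFieldType) (d n : nat)
  (T : rtester R d n) (q : nat) : Prop :=
  forall s, depth_le (alg T s) q.

Definition one_sided_unateness_tester (R : realFieldType) (d n : nat)
  (eps : R) (T : rtester R d n) : Prop :=
  is_distribution T /\
  (forall f : pt d n -> R, unate f -> prob_accept T f = 1) /\
  (forall f : pt d n -> R, eps_far f eps -> prob_accept T f <= 1 / 3%:R).

(* Main.v *)
(* For directions [dir], let [v_i s] count the pairs of a sparse "spanner" of the
   lines in dimension [i] that violate orientation [s].  Some function with
   directions [dir] differs from [f] in at most [4 * \sum_i v_i (dir i)] points.
   For Boolean functions one sorts the lines of one dimension after the other:
   sorting a dimension creates no violations in the others.  For real-valued [f],
   replaced by its ranks, take the L1-closest function [g] with directions [dir];
   each level set of [g] carries a Boolean function whose violations are violations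
   of [f], and optimality of [g] bounds its errors on the level set by the distance
   of that Boolean function to monotonicity.

   Taking the better direction in every dimension, [f] far from unate forces
   [\sum_i min (v_i true) (v_i false)] to be large.  The tester picks a random
   dimension and a random spanner pair in it; if that pair is violated in some
   orientation, it keeps sampling until the next violated pair and rejects if the
   orientations differ.  A violation is hit with probability [p] and followed by a
   search of expected length [1 / p], so a round costs O(1) queries on average. *)

Require Import Defs.
From HB Require Import structures.
From mathcomp Require Import all_boot all_order all_algebra zify ring lra.
Import Order.TTheory GRing.Theory Num.Theory.

Set Implicit Arguments.
Unset Strict Implicit.
Unset Printing Implicit Defensive.

Lemma card_set_sum (T : finType) (P : pred T) :
  #|[set x | P x]| = \sum_x (P x : nat).
Proof.
by rewrite -sum1_card big_mkcond; apply: eq_bigr => x _; rewrite inE; case: (P x).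
Qed.

(** * A two-hop spanner of the line *)

Section Spanner.

Variable n : nat.

Definition hop : finType := ('I_(trunc_log 2 n).+1 * bool)%type.

(** [p] hops to the multiple of [2 ^ k.1] at or below it, or to the next one. Outside the line the
    default is [p] itself, a loop that never counts as a violation. *)
Definition hop_to (p : 'I_n) (k : hop) : 'I_n :=
  insubd p ((p %/ 2 ^ k.1 + k.2) * 2 ^ k.1).

(** Halving keeps two numbers distinct until they are consecutive. *)
Lemma divn_exp2_succ (p q : nat) :
  p < q -> exists k, q %/ 2 ^ k = (p %/ 2 ^ k).+1.
Proof.
elim/ltn_ind: q p => q IH p lt_pq.
have [->|ne] := eqVneq q p.+1; first by exists 0; rewrite expn0 !divn1.
have lt1 : q %/ 2 < q by lia.
have lt2 : p %/ 2 < q %/ 2 by lia.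
have [k] := IH _ lt1 _ lt2.
by rewrite -!divnMA -expnS => e; exists k.+1.
Qed.

(** Once the dyadic blocks of [p] and [q] are adjacent, the first point of the block of [q] is one
    hop away from both. *)
Lemma hop_common (p q : 'I_n) : p < q ->
  exists k l, hop_to p k = hop_to q l /\ p <= hop_to p k <= q.
Proof.
move=> lt_pq; have [k ek] := divn_exp2_succ lt_pq.
have le_rq : (q %/ 2 ^ k) * 2 ^ k <= q by apply: leq_divM.
have lt_rn := leq_ltn_trans le_rq (ltn_ord q).
have lt_pr : p < (q %/ 2 ^ k) * 2 ^ k by rewrite ek ltn_ceil // expn_gt0.
(* [q %/ 2 ^ k] is a successor, so [2 ^ k <= q < n] and the level [k] exists in [hop]. *)
have le_kL : k < (trunc_log 2 n).+1.
  rewrite ltnS; apply: trunc_log_max => //.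
  apply: leq_trans (ltnW (ltn_ord q)); apply: leq_trans le_rq.
  by rewrite ek leq_pmull.
exists (Ordinal le_kL, true), (Ordinal le_kL, false).
have e1 : nat_of_ord (hop_to p (Ordinal le_kL, true)) = (q %/ 2 ^ k) * 2 ^ k.
  by rewrite /hop_to val_insubd /= addn1 -ek lt_rn.
have e2 : nat_of_ord (hop_to q (Ordinal le_kL, false)) = (q %/ 2 ^ k) * 2 ^ k.
  by rewrite /hop_to val_insubd /= addn0 lt_rn.
by split; [apply: val_inj; rewrite /= e1 e2 | rewrite e1 le_rq (ltnW lt_pr)].
Qed.

End Spanner.

(** * Sorting Boolean functions on a line *)

Section Lines.

Variable n : nat.

(* The flag [true] stands for the direction up, [false] for down. *)
Definition ltd (s : bool) (p q : 'I_n) : bool := if s then p < q else q < p.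

Definition viol (T : Type) (lt : rel T) (s : bool) (p q : 'I_n) (a b : T) :=
  ltd s p q && lt b a || ltd s q p && lt a b.

(** Rank 0 is the end where the largest value belongs, so a sorted Boolean function is true on an
    initial segment of ranks. *)
Definition rank (s : bool) (z : 'I_n) : 'I_n := if s then rev_ord z else z.

Lemma rankK s : involutive (rank s).
Proof. by case: s => z //=; rewrite rev_ordK. Qed.

Lemma ltd_rank s (p q : 'I_n) : ltd s p q = (rank s q < rank s p).
Proof. by case: s => //=; have := ltn_ord p; have := ltn_ord q; lia. Qed.

Lemma ltd_asym s (p q : 'I_n) : ltd s p q -> ltd s q p = false.
Proof. by rewrite !ltd_rank; lia. Qed.

Lemma sum_rank_lt s k : k <= n -> \sum_(z < n) (rank s z < k : nat) = k.
Proof.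
move=> le_kn; rewrite (reindex_inj (inv_inj (rankK s))) /=.
under eq_bigr => z _ do rewrite rankK.
rewrite -big_mkcond /= -(big_ord_widen n (fun=> 1) le_kn).
by rewrite sum1_card card_ord.
Qed.

Lemma count_le (h : 'I_n -> bool) : \sum_z (h z : nat) <= n.
Proof.
rewrite -[X in _ <= X]card_ord -sum1_card; apply: leq_sum => z _.
exact: leq_b1.
Qed.

Definition line_sort (s : bool) (h : 'I_n -> bool) (z : 'I_n) : bool :=
  rank s z < \sum_z (h z : nat).

Lemma sum_line_sort s h : \sum_z (line_sort s h z : nat) = \sum_z (h z : nat).
Proof. exact: sum_rank_lt (count_le h). Qed.

(** Sorted functions are nested segments, so their excess is the truncated difference of the two
    counts, a lower bound for any arrangement. This is why sorting one dimension creates no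
    violations in another. *)
Lemma line_sort_excess s (h h' : 'I_n -> bool) :
  \sum_z ((line_sort s h' z < line_sort s h z)%N : nat) <=
  \sum_z ((h' z < h z)%N : nat).
Proof.
set k1 := \sum_z (h z : nat); set k2 := \sum_z (h' z : nat).
have le1 : k1 <= \sum_z ((h' z < h z)%N : nat) + k2.
  rewrite -big_split; apply: leq_sum => z _.
  by case: (h z); case: (h' z).
have le2 : \sum_z ((line_sort s h' z < line_sort s h z)%N : nat)
    + minn k1 k2 <= k1.
  have kn : minn k1 k2 <= n by rewrite geq_min count_le.
  rewrite -{1}(sum_rank_lt s kn) -[X in _ <= X](sum_line_sort s).
  rewrite -big_split; apply: leq_sum => z _.
  rewrite /line_sort -/k1 -/k2 leq_min.
  by case: (_ < k1); case: (_ < k2).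
by move: le1 le2; lia.
Qed.

(** Sorting changes equally many values in each direction. A wrongly true and a wrongly false point
    violate [s], and the value at their common hop makes one of the two hops a violation. Hence all
    errors of one kind start violated hops, which gives the factor 2. *)
Lemma line_sort_dist s (h : 'I_n -> bool) :
  \sum_z ((line_sort s h z != h z) : nat) <=
  2 * \sum_(k : hop n) \sum_z (viol ltn s z (hop_to z k) (h z) (h (hop_to z k)) : nat).
Proof.
pose bad z := [exists k, viol ltn s z (hop_to z k) (h z) (h (hop_to z k))].
pose low := [set z | h z && ~~ line_sort s h z].
pose high := [set z | ~~ h z && line_sort s h z].
have eqlh : #|low| = #|high|.
  have : \sum_z (h z : nat) + #|high| = \sum_z (line_sort s h z : nat) + #|low|.
    rewrite !card_set_sum -!big_split; apply: eq_bigr => z _ /=.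
    by case: (h z); case: (line_sort s h z).
  by rewrite sum_line_sort => /addnI.
have -> : \sum_z ((line_sort s h z != h z) : nat) = #|low| + #|high|.
  rewrite !card_set_sum -!big_split; apply: eq_bigr => z _ /=.
  by case: (h z); case: (line_sort s h z).
have badle : #|[set z | bad z]| <= \sum_(k : hop n) \sum_z
    (viol ltn s z (hop_to z k) (h z) (h (hop_to z k)) : nat).
  rewrite exchange_big card_set_sum; apply: leq_sum => z _.
  case: (boolP (bad z)) => // /existsP [k vk].
  by rewrite (bigD1 k) //= vk.
rewrite eqlh addnn -mul2n leq_mul2l /=; apply: leq_trans badle.
suff [lowbad|highbad] : low \subset [set z | bad z] \/ high \subset [set z | bad z].
- by rewrite -eqlh subset_leq_card.
- by rewrite subset_leq_card.
case: (boolP (low \subset _)) => [|/subsetPn [z0]]; first by left.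
rewrite !inE => /andP [hz0 sz0] bz0; right; apply/subsetP => z1.
rewrite !inE => /andP [hz1 sz1]; apply: contraR bz0 => bz1.
have lt01 : ltd s z0 z1.
  by rewrite ltd_rank; move: sz0 sz1; rewrite /line_sort; lia.
have [k [l [ekl bet]]] : exists k l, hop_to z0 k = hop_to z1 l /\
    (hop_to z0 k == z0 \/ ltd s z0 (hop_to z0 k)) /\
    (hop_to z0 k == z1 \/ ltd s (hop_to z0 k) z1).
  move: lt01; case: (s) => /= lt01.
    have [k [l [e /andP [le1 le2]]]] := hop_common lt01.
    by exists k, l; split => //; split; rewrite -val_eqE /=; lia.
  have [l [k [e /andP [le1 le2]]]] := hop_common lt01.
  by exists k, l; rewrite -e; split => //; split; rewrite -val_eqE /=; lia.
have {bz1} nv1 := existsPn bz1 l; rewrite -ekl in nv1.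
apply/existsP; exists k; move: bet nv1; rewrite /viol hz0 (negbTE hz1).
case ew: (h (hop_to z0 k)) => -[at0 at1] /=.
  by case: at1 => [/eqP e1|->]; [rewrite -e1 ew in hz1 | rewrite orbT].
by case: at0 => [/eqP e0|->]; [rewrite e0 hz0 in ew |].
Qed.

End Lines.

(** * Dimension reduction for Boolean functions on the grid *)

Section Grid.

Variables d n : nat.
Implicit Types (x y : pt d n) (i j : 'I_d) (z : 'I_n).

Definition upd x i z : pt d n := [ffun j => if j == i then z else x j].

Lemma upd_at x i z : upd x i z i = z.
Proof. by rewrite ffunE eqxx. Qed.

Lemma upd_other x i j z : j != i -> upd x i z j = x j.
Proof. by rewrite ffunE => /negbTE ->. Qed.

Lemma upd_upd x i z z' : upd (upd x i z) i z' = upd x i z'.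
Proof. by apply/ffunP => j; rewrite !ffunE; case: eqP. Qed.

Lemma upd_id x i : upd x i (x i) = x.
Proof. by apply/ffunP => j; rewrite !ffunE; case: eqP => // ->. Qed.

Lemma updC x i j z z' : i != j ->
  upd (upd x i z) j z' = upd (upd x j z') i z.
Proof.
move=> ne; apply/ffunP => l; rewrite !ffunE.
by case: (l =P j) => // ->; rewrite eq_sym (negbTE ne).
Qed.

Lemma sum_lines j (phi : pt d n -> nat) :
  \sum_x \sum_z phi (upd x j z) = n * \sum_x phi x.
Proof.
pose swap (u : pt d n * 'I_n) := (upd u.1 j u.2, u.1 j).
have swapK : involutive swap.
  by case=> x z; rewrite /swap /= upd_upd upd_id upd_at.
rewrite pair_bigA (reindex_inj (inv_inj swapK)) /=.
under eq_bigr => u _ do rewrite upd_upd upd_id.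
rewrite -(pair_bigA _ (fun x (_ : 'I_n) => phi x)) /= big_distrr /=.
by apply: eq_bigr => x _; rewrite sum_nat_const card_ord.
Qed.

(** Summing the line inequality over all base points counts every line [n] times on both sides. *)
Lemma leq_sum_lines j c (phi psi : pt d n -> nat) :
  (forall x, \sum_z phi (upd x j z) <= c * \sum_z psi (upd x j z)) ->
  \sum_x phi x <= c * \sum_x psi x.
Proof.
move=> le; case: (posnP n) => [n0|n_gt0].
  by rewrite big1 // => x _; have := ltn_ord (x j); rewrite [X in _ < X]n0.
rewrite -(leq_pmul2l n_gt0) mulnCA -!(sum_lines j) big_distrr /=.
exact: leq_sum.
Qed.

(** The partner map [zeta] is arbitrary: hops give the spanner violations, and the constant maps
    together detect monotonicity. *)
Definition nviol (s : bool) i (zeta : 'I_n -> 'I_n) (r : pt d n -> nat) : nat :=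
  \sum_(x : pt d n) (viol ltn s (x i) (zeta (x i)) (r x) (r (upd x i (zeta (x i)))) : nat).

Definition hop_viol (s : bool) i (r : pt d n -> nat) : nat :=
  \sum_(k : hop n) nviol s i (fun p => hop_to p k) r.

Definition mono_at (s : bool) i (r : pt d n -> nat) : Prop :=
  forall x z, ltd s (x i) z -> r x <= r (upd x i z).

Definition mono (dir : 'I_d -> bool) (r : pt d n -> nat) : Prop :=
  forall i, mono_at (dir i) i r.

Definition sort_at (s : bool) j (b : pt d n -> bool) x : bool :=
  line_sort s (fun z => b (upd x j z)) (x j).

Lemma sort_at_upd s j b x z :
  sort_at s j b (upd x j z) = line_sort s (fun z => b (upd x j z)) z.
Proof.
rewrite /sort_at /line_sort upd_at.
by under eq_bigr => z' _ do rewrite upd_upd.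
Qed.

Lemma mono_at_sort_at s j b : mono_at s j (sort_at s j b).
Proof.
move=> x z; rewrite ltd_rank -[in sort_at _ _ _ x](upd_id x j) !sort_at_upd.
rewrite /line_sort => lt; case: (ltnP (rank s (x j))) => //= lt'.
by rewrite (ltn_trans lt lt').
Qed.

(** Partners along [i] pair up two parallel lines in dimension [j]; the violations between them are
    an excess as in [line_sort_excess]. *)
Lemma nviol_sort_at s s' i j zeta (b : pt d n -> bool) : i != j ->
  nviol s i zeta (sort_at s' j b) <= nviol s i zeta b.
Proof.
move=> ne; rewrite -[X in _ <= X]mul1n; apply: (@leq_sum_lines j) => x.
rewrite mul1n; set p := x i; set q := zeta p; set y := upd x i q.
under eq_bigr => z _ do
  rewrite upd_other // -/p -/q updC 1?eq_sym // -/y !sort_at_upd.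
under [X in _ <= X]eq_bigr => z _ do
  rewrite upd_other // -/p -/q updC 1?eq_sym // -/y.
rewrite /viol; case: (boolP (ltd s p q)) => [lt|_].
  rewrite (ltd_asym lt) /=.
  under eq_bigr => z _ do rewrite orbF.
  under [X in _ <= X]eq_bigr => z _ do rewrite orbF.
  exact: (line_sort_excess s' (fun z => b (upd x j z)) (fun z => b (upd y j z))).
case: (ltd s q p) => /=; last by rewrite big1.
exact: (line_sort_excess s' (fun z => b (upd y j z)) (fun z => b (upd x j z))).
Qed.

Lemma dist_sort_at s j (b : pt d n -> bool) :
  \sum_x ((sort_at s j b x != b x) : nat) <= 2 * hop_viol s j b.
Proof.
rewrite /hop_viol /nviol exchange_big /=; apply: (@leq_sum_lines j) => x.
under eq_bigr => z _ do rewrite sort_at_upd.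
apply: leq_trans (line_sort_dist s (fun z => b (upd x j z))) _.
rewrite exchange_big leq_mul2l /=; apply: leq_sum => z _; apply: leq_sum => k _.
by rewrite upd_at upd_upd.
Qed.

Lemma nviol_mono_at s i zeta r : mono_at s i r -> nviol s i zeta r = 0.
Proof.
move=> mono_r; rewrite /nviol big1 // => x _; apply/eqP; rewrite eqb0 /viol /=.
set z := zeta (x i); apply/norP; split; apply/negP => /andP [lt].
  by rewrite ltnNge mono_r.
have := mono_r (upd x i z) (x i); rewrite upd_at upd_upd upd_id ltnNge.
by move=> /(_ lt) ->.
Qed.

Lemma mono_at_nviol s i r : (forall z, nviol s i (fun=> z) r = 0) -> mono_at s i r.
Proof.
move=> nv x z lt; have /eqP := nv z; rewrite sum_nat_eq0 => /forallP /(_ x).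
by rewrite eqb0 /viol /= lt /= negb_or -leqNgt => /andP [].
Qed.

Lemma bool_dimension_reduction (dir : 'I_d -> bool) (b : pt d n -> bool) :
  exists u : pt d n -> bool, mono dir u /\
    \sum_x ((b x != u x) : nat) <= 2 * \sum_i hop_viol (dir i) i b.
Proof.
(* Induction over the dimensions: the sorted ones stay sorted, and the others have no more
   violations than in [b], so each sort is paid for by the original counts. *)
suff [u [mono_u _ le_u]] : exists u : pt d n -> bool,
    [/\ (forall i, i \in enum 'I_d -> mono_at (dir i) i u),
       (forall i zeta, i \notin enum 'I_d ->
         nviol (dir i) i zeta u <= nviol (dir i) i zeta b) &
       \sum_x ((b x != u x) : nat) <=
         2 * \sum_(i <- enum 'I_d) hop_viol (dir i) i b].
  exists u; split; first by move=> i; apply: mono_u; rewrite mem_enum.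
  by rewrite big_enum in le_u.
elim: (enum 'I_d) (enum_uniq 'I_d) => [_|j s IH /= /andP [js us]].
  by exists b; split=> //; rewrite big1 // => x _; rewrite eqxx.
have [u [mono_u nv_u le_u]] := IH us.
exists (sort_at (dir j) j u); split.
- move=> i; rewrite inE; case: eqVneq => [-> _|ne /= i_s].
    exact: mono_at_sort_at.
  apply: mono_at_nviol => z; apply/eqP; rewrite -leqn0.
  apply: leq_trans (nviol_sort_at _ _ _ _ ne) _.
  by rewrite nviol_mono_at //; apply: mono_u.
- move=> i zeta; rewrite inE negb_or => /andP [ne i_s].
  exact: leq_trans (nviol_sort_at _ _ _ _ ne) (nv_u _ _ i_s).
- rewrite big_cons mulnDr addnC.
  have hv : hop_viol (dir j) j u <= hop_viol (dir j) j b.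
    by apply: leq_sum => k _; apply: nv_u.
  apply: leq_trans (leq_add le_u (leq_trans (dist_sort_at (dir j) j u) _)).
    rewrite -big_split; apply: leq_sum => x _ /=.
    by case: (b x); case: (u x); case: sort_at.
  by rewrite leq_mul2l.
Qed.

End Grid.

(** * From Boolean to natural values through level sets *)

Section LevelSets.

Variables (d n : nat) (dir : 'I_d -> bool) (r : pt d n -> nat).
Implicit Types (x y : pt d n) (g : pt d n -> nat).

Definition l1_dist g : nat := \sum_x ((r x - g x) + (g x - r x)).

(** Capping the values at [N] leaves finitely many candidates, among them the zero function. *)
Lemma exists_l1_closest N : exists g,
  [/\ mono dir g, (forall x, g x <= N) &
    forall g', mono dir g' -> (forall x, g' x <= N) -> l1_dist g <= l1_dist g'].
Proof.
pose P (g : {ffun pt d n -> 'I_N.+1}) := [forall i, forall x : pt d n, forall z,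
  ltd (dir i) (x i) z ==> (g x <= g (upd x i z))].
have P0 : P [ffun=> ord0].
  by do 3!apply/forallP => ?; rewrite !ffunE implybT.
case: (arg_minnP (fun g : {ffun pt d n -> 'I_N.+1} => l1_dist (fun x => g x)) P0) => g Pg min_g.
exists (fun x => nat_of_ord (g x)); split=> [i x z lt|x|g' mono_g' le_g'].
- by have /forallP /(_ i) /forallP /(_ x) /forallP /(_ z) := Pg; rewrite lt.
- by rewrite -ltnS ltn_ord.
have val_g' x : (inord (g' x) : 'I_N.+1) = g' x :> nat by rewrite inordK // ltnS le_g'.
have Pg' : P [ffun x => inord (g' x)].
  do 3!apply/forallP => ?; apply/implyP => lt.
  by rewrite !ffunE !val_g' mono_g'.
apply: leq_trans (min_g _ Pg') _; apply: leq_sum => x _.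
by rewrite ffunE val_g'.
Qed.

(* Outside the level set [g = e + t] this agrees with the monotone function
   [e + t < g], so all its violations lie inside the level set. *)
Definition level_cut g (e t : nat) x : bool :=
  (e + t < g x) || (g x == e + t) && (t < r x).

Lemma viol_level_cut g e t s i x z : mono_at s i g ->
  viol ltn s (x i) z (level_cut g e t x : nat) (level_cut g e t (upd x i z)) ->
  (g x == e + t) && viol ltn s (x i) z (r x) (r (upd x i z)).
Proof.
move=> mono_g; rewrite /viol /=; set y := upd x i z.
have cut a b : g a <= g b -> level_cut g e t b < level_cut g e t a ->
    [&& g a == e + t, g b == e + t & r b < r a].
  by rewrite /level_cut; lia.
case/orP => /andP [lt].
  by move/(cut _ _ (mono_g _ _ lt)) => /and3P [-> _ ->]; rewrite lt.
have le : g y <= g x.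
  by have := mono_g y (x i); rewrite upd_at upd_upd upd_id; apply.
by move/(cut _ _ le) => /and3P [_ -> ->]; rewrite lt orbT.
Qed.

(** The value [g x] determines [t], so each violation of [r] is charged to at most one level. *)
Lemma sum_hop_viol_level_cut g e s i N : mono_at s i g ->
  \sum_(t < N) hop_viol s i (level_cut g e t) <= hop_viol s i r.
Proof.
move=> mono_g; rewrite exchange_big; apply: leq_sum => k _.
rewrite exchange_big; apply: leq_sum => x _ /=.
apply: (@leq_trans (\sum_(t < N) ((g x == e + t) &&
    viol ltn s (x i) (hop_to (x i) k) (r x) (r (upd x i (hop_to (x i) k))) : nat))).
  apply: leq_sum => t _; case: (boolP (viol _ _ _ _ _ _)) => // v.
  by rewrite (viol_level_cut mono_g v).
case: (boolP (viol _ _ _ _ _ _)) => [_|_]; last first.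
  by rewrite big1 // => t _; rewrite andbF.
have [/existsP [t0 e0]|/existsPn none] := boolP [exists t : 'I_N, g x == e + t].
  rewrite (bigD1 t0) //= e0 big1 // => t ne; rewrite andbT; apply/eqP.
  rewrite eqb0; apply: contra ne => /eqP et; apply/eqP; apply: val_inj => /=.
  by move: e0 et; lia.
by rewrite big1 // => t _; rewrite (negbTE (none t)).
Qed.

(** [F x t] marks the errors charged to level [t]. The shift [e] is 0 when values of [g] that are
    too small get raised, and 1 when values that are too large get lowered. *)
Lemma sum_level_cut_dist g e N (F : pt d n -> nat -> bool) : mono dir g ->
  (forall (t : 'I_N) (u : pt d n -> bool), mono dir u ->
     \sum_x (F x t : nat) <= \sum_x ((level_cut g e t x != u x) : nat)) ->
  \sum_x \sum_(t < N) (F x t : nat) <= 2 * \sum_i hop_viol (dir i) i r.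
Proof.
move=> mono_g le_F; rewrite exchange_big /=.
apply: (@leq_trans (\sum_(t < N) 2 * \sum_i hop_viol (dir i) i (level_cut g e t))).
  apply: leq_sum => t _.
  have [u [mono_u le_u]] := bool_dimension_reduction dir (level_cut g e t).
  exact: leq_trans (le_F t u mono_u) le_u.
rewrite -big_distrr leq_mul2l /= exchange_big; apply: leq_sum => i _.
exact: sum_hop_viol_level_cut.
Qed.

(* Moving the closest monotone [g] by one on the part of a level set cut out by
   a monotone Boolean [u] cannot decrease the L1 distance; this plays the role of
   Hall's condition and avoids matchings in the violation graph. *)
Lemma nat_dimension_reduction : exists2 g, mono dir g &
  \sum_x ((r x != g x) : nat) <= 4 * \sum_i hop_viol (dir i) i r.
Proof.
pose N := \max_x r x.
have le_rN x : r x <= N by apply: leq_bigmax.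
have [g [mono_g le_gN min_g]] := exists_l1_closest N.
exists g => //.
(* An error with [g x < r x] is charged to [t = g x], one with [r x < g x] to [t = g x - 1]; each
   kind contributes a factor 2. *)
apply: (@leq_trans (\sum_x \sum_(t < N) ((g x == t) && (t < r x) : nat) +
                    \sum_x \sum_(t < N) ((g x == t.+1) && (r x <= t) : nat))).
  rewrite -big_split; apply: leq_sum => x _ /=.
  case: (ltngtP (r x) (g x)) => // lt.
    have lt_tN : (g x).-1 < N by have := le_gN x; lia.
    apply: leq_trans (leq_addl _ _).
    rewrite (bigD1 (Ordinal lt_tN)) //=.
    by have -> : (g x == (g x).-1.+1) && (r x <= (g x).-1) by lia.
  have lt_tN : g x < N by have := le_rN x; lia.
  by rewrite (bigD1 (Ordinal lt_tN)) //= eqxx lt.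
rewrite (mulnDl 2 2); apply: leq_add.
- apply: (@sum_level_cut_dist g 0 N (fun x t => (g x == t) && (t < r x))) => // t u mono_u.
  pose g' x := if (g x == t) && u x then t.+1 else g x.
  have mono_g' : mono dir g'.
    move=> i x z lt; have := mono_g i x z lt; have := mono_u i x z lt.
    by rewrite /g' /=; case: (u x); case: (u _) => //= _; do ?case: ifP; lia.
  have le_g' x : g' x <= N.
    by rewrite /g'; case: ifP => // _; apply: ltn_ord.
  have := min_g _ mono_g' le_g'.
  have : l1_dist g' + \sum_x ((g x == t) && (t < r x) : nat) <=
         l1_dist g + \sum_x ((level_cut g 0 t x != u x) : nat).
    rewrite -!big_split; apply: leq_sum => x _ /=.
    by rewrite /g' /level_cut; case: (u x); case: ifP; lia.
  by lia.
- apply: (@sum_level_cut_dist g 1 N (fun x t => (g x == t.+1) && (r x <= t))) => // t u mono_u.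
  pose g' x := if (g x == t.+1) && ~~ u x then nat_of_ord t else g x.
  have mono_g' : mono dir g'.
    move=> i x z lt; have := mono_g i x z lt; have := mono_u i x z lt.
    by rewrite /g' /=; case: (u x); case: (u _) => //= _; do ?case: ifP; lia.
  have le_g' x : g' x <= N.
    by rewrite /g'; case: ifP => // _; apply: ltnW.
  have := min_g _ mono_g' le_g'.
  have : l1_dist g' + \sum_x ((g x == t.+1) && (r x <= t) : nat) <=
         l1_dist g + \sum_x ((level_cut g 1 t x != u x) : nat).
    rewrite -!big_split; apply: leq_sum => x _ /=.
    by rewrite /g' /level_cut; case: (u x); case: ifP; lia.
  by lia.
Qed.

End LevelSets.

Local Open Scope ring_scope.

(** * From ranks to real values *)

Section RealValued.

Variables (R : realFieldType) (d n : nat).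
Implicit Types (f g : pt d n -> R) (x y v : pt d n).

Lemma mono_unate (dir : 'I_d -> bool) (g : pt d n -> R) :
  (forall i x z, ltd (dir i) (x i) z -> g x <= g (upd x i z)) -> unate g.
Proof.
move=> mono_g; exists dir => i x y /andP [/eqP ey /forallP eqxy].
have -> : y = upd x i (y i).
  apply/ffunP => j; rewrite ffunE; case: eqVneq => [->//|ne].
  by apply/eqP; have := eqxy j; rewrite ne.
move: (mono_g i); rewrite /ltd; case: (dir i) => mono_i.
  by apply: mono_i; rewrite ey.
have := mono_i (upd x i (y i)) (x i); rewrite upd_at upd_upd upd_id ey.
exact.
Qed.

Definition real_rank f x : nat := #|[set v | f v < f x]|.

Lemma real_rank_lt f x y : (real_rank f x < real_rank f y)%N = (f x < f y).
Proof.
have le a b : f a <= f b -> (real_rank f a <= real_rank f b)%N.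
  move=> le_ab; apply: subset_leq_card; apply/subsetP => v; rewrite !inE => lt.
  exact: lt_le_trans lt le_ab.
case: (leP (f y) (f x)) => [/le|lt]; first by rewrite ltnNge => ->.
apply: proper_card; apply/properP; split; last by exists x; rewrite inE ?ltxx.
by apply/subsetP => v; rewrite !inE => /lt_trans; apply.
Qed.

Lemma real_rank_le f x y : (real_rank f x <= real_rank f y)%N = (f x <= f y).
Proof. by rewrite leqNgt real_rank_lt leNgt. Qed.

Definition dim_viol f (i : 'I_d) (s : bool) : nat :=
  \sum_(k : hop n) \sum_(x : pt d n)
    viol <%R s (x i) (hop_to (x i) k) (f x) (f (upd x i (hop_to (x i) k))).

Lemma hop_viol_rank f i s : hop_viol s i (real_rank f) = dim_viol f i s.
Proof.
by do 2!apply: eq_bigr => ? _; rewrite /viol /= !real_rank_lt.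
Qed.

(** The natural function [h] near the ranks may take values that are not ranks. Rounding down to an
    attained rank keeps it monotone and keeps every point where it agrees with the rank of [f]. *)
Lemma dimension_reduction (dir : 'I_d -> bool) f :
  exists2 g, unate g &
    (#|[set x | f x != g x]| <= 4 * \sum_i dim_viol f i (dir i))%N.
Proof.
have [/existsP [x1 _]|/existsPn none] := boolP [exists x : pt d n, true]; last first.
  by exists f; [exists dir => i x; have := none x
    | rewrite eq_card0 // => x; have := none x].
have [h mono_h le_h] := nat_dimension_reduction dir (real_rank f).
(* A minimum of [f] has rank 0, so some attained rank always lies at or below [h x]. *)
pose x0 := [arg min_(v < x1) real_rank f v]%N.
have min_x0 v : (real_rank f x0 <= real_rank f v)%N.
  by rewrite /x0; case: arg_minnP => // w _; apply.
have rank_x0 : real_rank f x0 = 0%N.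
  apply/eqP; rewrite cards_eq0; apply/eqP/setP => v; rewrite !inE.
  by rewrite -real_rank_lt ltnNge min_x0.
have ok x : (real_rank f x0 <= h x)%N by rewrite rank_x0.
pose w x := [arg max_(v > x0 | (real_rank f v <= h x)%N) real_rank f v]%N.
have wP x : (real_rank f (w x) <= h x)%N /\
    (forall v, real_rank f v <= h x -> real_rank f v <= real_rank f (w x))%N.
  by rewrite /w; case: arg_maxnP => // v le max_v; split=> // ?; apply: max_v.
exists (fun x => f (w x)).
  apply: (@mono_unate dir) => i x z lt; rewrite -real_rank_le.
  have [lex _] := wP x; have [_ maxy] := wP (upd x i z).
  by apply: maxy; apply: leq_trans lex (mono_h _ _ _ lt).
have <- : (\sum_i hop_viol (dir i) i (real_rank f) = \sum_i dim_viol f i (dir i))%N.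
  by apply: eq_bigr => i _; apply: hop_viol_rank.
apply: leq_trans le_h; rewrite card_set_sum; apply: leq_sum => x _.
case: (eqVneq (real_rank f x) (h x)) => [e|_]; last exact: leq_b1.
have [le max_w] := wP x.
suff -> : f x = f (w x) by rewrite eqxx.
by apply/eqP; rewrite eq_le -!real_rank_le max_w ?e //= -e.
Qed.

End RealValued.

(** * Truncation and composition of decision trees *)

Section DecisionTrees.

Variables P V : Type.
Implicit Types (t : dtree P V) (f : P -> V).

Fixpoint cost t f : nat :=
  if t is Query x k then (cost (k (f x)) f).+1 else 0.

(** Accepting when the budget runs out preserves the one-sided error. *)
Fixpoint trunc t (q : nat) : dtree P V :=
  match t with
  | Leaf b => Leaf P V b
  | Query x k => if q is q'.+1 then Query x (fun v => trunc (k v) q')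
                 else Leaf P V true
  end.

Fixpoint seqt t1 t2 : dtree P V :=
  match t1 with
  | Leaf b => if b then t2 else Leaf P V false
  | Query x k => Query x (fun v => seqt (k v) t2)
  end.

Lemma depth_trunc t q : depth_le (trunc t q) q.
Proof.
elim: t q => [b|x k IH] [|q] /=; try exact: depth_leaf.
by apply: depth_query => v; apply: IH.
Qed.

Lemma run_trunc t q f : run (trunc t q) f = (q < cost t f)%N || run t f.
Proof. by elim: t q => [b|x k IH] [|q] //=; rewrite IH. Qed.

Lemma run_seqt t1 t2 f : run (seqt t1 t2) f = run t1 f && run t2 f.
Proof. by elim: t1 => [[]|x k IH] //=. Qed.

Lemma cost_seqt t1 t2 f : (cost (seqt t1 t2) f <= cost t1 f + cost t2 f)%N.
Proof. by elim: t1 => [[]|x k IH] //=; rewrite addSn ltnS. Qed.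

End DecisionTrees.

(** * Uniform averages and product seeds *)

Section Averages.

Variable R : realFieldType.

Definition avg (S : finType) (F : S -> R) : R := (\sum_s F s) / #|S|%:R.

Lemma eq_avg (S : finType) (F G : S -> R) : F =1 G -> avg F = avg G.
Proof. by move=> eqFG; rewrite /avg (eq_bigr _ (fun s _ => eqFG s)). Qed.

Lemma ler_avg (S : finType) (F G : S -> R) :
  (forall s, F s <= G s) -> avg F <= avg G.
Proof.
move=> leFG; rewrite ler_wpM2r ?invr_ge0 ?ler0n //.
by apply: ler_sum => s _.
Qed.

Lemma avg_ge0 (S : finType) (F : S -> R) : (forall s, 0 <= F s) -> 0 <= avg F.
Proof. by move=> F0; rewrite divr_ge0 ?ler0n // sumr_ge0. Qed.

Lemma avg_const (S : finType) (c : R) : (0 < #|S|)%N -> avg (fun _ : S => c) = c.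
Proof.
move=> S0; rewrite /avg sumr_const -[c *+ _]mulr_natr mulfK // pnatr_eq0 -lt0n.
by rewrite S0.
Qed.

Lemma avgD (S : finType) (F G : S -> R) :
  avg (fun s => F s + G s) = avg F + avg G.
Proof. by rewrite /avg big_split mulrDl. Qed.

Lemma avgZ (S : finType) (c : R) (F : S -> R) :
  avg (fun s => c * F s) = c * avg F.
Proof. by rewrite /avg -mulr_sumr mulrA. Qed.

Lemma avg_pair (S T : finType) (F : S * T -> R) :
  avg F = avg (fun s => avg (fun t => F (s, t))).
Proof.
rewrite /avg card_prod natrM invfM mulrA -mulr_suml pair_bigA /= mulrAC.
by congr (_ / _ / _); apply: eq_bigr => -[].
Qed.

(** Nested pairs let [avg_pair] peel off one independent seed at a time. *)
Fixpoint tpow (S : finType) (m : nat) : finType :=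
  if m is m'.+1 then (S * tpow S m')%type else unit.

Lemma tpow_gt0 (S : finType) m : (0 < #|S|)%N -> (0 < #|tpow S m|)%N.
Proof.
by move=> S0; elim: m => [|m IH] /=; rewrite ?card_unit // card_prod muln_gt0 S0.
Qed.

Lemma bernoulli_inv (p : R) N : 0 <= p -> p <= 1 ->
  (1 - p) ^+ N * (1 + N%:R * p) <= 1.
Proof.
move=> p0 p1; elim: N => [|N IH]; first by rewrite expr0; lra.
apply: le_trans IH; rewrite exprSr -mulrA ler_wpM2l ?exprn_ge0 ?subr_ge0 //.
rewrite -natr1.
have : 0 <= N%:R * p ^+ 2 by rewrite mulr_ge0 ?ler0n // sqr_ge0.
have : 0 <= p ^+ 2 by rewrite sqr_ge0.
by lra.
Qed.

End Averages.

(** * Independent repetition *)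

Section Repetition.

Variables (R : realFieldType) (P V : Type) (S : finType) (t : S -> dtree P V).
Hypothesis S_gt0 : (0 < #|S|)%N.

Fixpoint rep (m : nat) : tpow S m -> dtree P V :=
  if m is m'.+1 then fun ss => seqt (t ss.1) (rep ss.2) else fun=> Leaf P V true.

Lemma avg_run_rep f m :
  avg (fun ss : tpow S m => (run (rep ss) f)%:R : R) =
  avg (fun s => (run (t s) f)%:R : R) ^+ m.
Proof.
elim: m => [|m IH]; first by rewrite avg_const ?card_unit.
rewrite avg_pair exprS -IH mulrC -avgZ; apply: eq_avg => s.
rewrite mulrC -avgZ; apply: eq_avg => ss /=.
by rewrite run_seqt -mulnb natrM.
Qed.

(** Linearity of expectation, as an inequality because a rejection skips the remaining trees. *)
Lemma avg_cost_rep f m :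
  avg (fun ss : tpow S m => (cost (rep ss) f)%:R : R) <=
  m%:R * avg (fun s => (cost (t s) f)%:R : R).
Proof.
elim: m => [|m IH]; first by rewrite avg_const ?card_unit // mul0r.
apply: (@le_trans _ _ (avg (fun ss : tpow S m.+1 =>
   (cost (t ss.1) f)%:R + (cost (rep ss.2) f)%:R : R))).
  by apply: ler_avg => ss; rewrite -natrD ler_nat cost_seqt.
rewrite avg_pair /=.
rewrite (eq_avg (G := fun s => (cost (t s) f)%:R +
   avg (fun ss : tpow S m => (cost (rep ss) f)%:R : R))); last first.
  by move=> s; rewrite avgD avg_const // tpow_gt0.
by rewrite avgD avg_const // -natr1 mulrDl mul1r addrC lerD2r.
Qed.

Lemma rep_accepts f m : (forall s, run (t s) f) ->
  forall ss : tpow S m, run (rep ss) f.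
Proof. by move=> acc; elim: m => [|m IH] //= ss; rewrite run_seqt acc IH. Qed.

(* The last term is Markov's bound on the probability that the cut is reached. *)
Lemma avg_run_trunc_rep f m q (c : R) : (0 < q)%N ->
  avg (fun s => (cost (t s) f)%:R) <= c ->
  avg (fun ss : tpow S m => (run (trunc (rep ss) q) f)%:R : R) <=
  avg (fun s => (run (t s) f)%:R : R) ^+ m + m%:R * c / q%:R.
Proof.
move=> q0 le_c; rewrite -avg_run_rep.
apply: (@le_trans _ _ (avg (fun ss : tpow S m =>
   (run (rep ss) f)%:R + q%:R^-1 * (cost (rep ss) f)%:R : R))).
  apply: ler_avg => ss; rewrite run_trunc.
  have cost0 : 0 <= q%:R^-1 * (cost (rep ss) f)%:R :> R.
    by rewrite mulr_ge0 ?invr_ge0 ?ler0n.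
  case: (ltnP q) => [lt|_] /=; last by rewrite lerDl.
  apply: (@le_trans _ _ (q%:R^-1 * (cost (rep ss) f)%:R)); last by rewrite lerDr ler0n.
  by rewrite mulrC ler_pdivlMr ?ltr0n // mul1r ler_nat ltnW.
rewrite avgD avgZ lerD2l mulrC ler_wpM2r ?invr_ge0 ?ler0n //.
by apply: le_trans (avg_cost_rep f m) _; rewrite ler_wpM2l ?ler0n.
Qed.

End Repetition.

(** * One round of the tester *)

Section Round.

Variables (R : realFieldType) (d n : nat).
Implicit Types (f : pt d n -> R) (i : 'I_d).

Definition probe_seed : finType := (pt d n * hop n)%type.

Implicit Type (w : probe_seed).

Definition probe_end i w : pt d n := upd w.1 i (hop_to (w.1 i) w.2).

Definition orientation (p q : 'I_n) (a b : R) : option bool :=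
  if viol <%R true p q a b then Some true
  else if viol <%R false p q a b then Some false else None.

Definition outcome f i w : option bool :=
  orientation (w.1 i) (hop_to (w.1 i) w.2) (f w.1) (f (probe_end i w)).

Definition probe i w (k : option bool -> dtree (pt d n) R) : dtree (pt d n) R :=
  Query w.1 (fun a => Query (probe_end i w) (fun b =>
    k (orientation (w.1 i) (hop_to (w.1 i) w.2) a b))).

(** The first violated pair decides; a search that meets none accepts, so a rejection always rests
    on two violations of opposite orientation. *)
Fixpoint seek i (s : bool) (N : nat) : tpow probe_seed N -> dtree (pt d n) R :=
  if N is N'.+1 then fun ws =>
    probe i ws.1 (fun o => if o is Some s' then Leaf _ _ (s' == s) else seek i s ws.2)
  else fun=> Leaf _ _ true.

Definition round_seed (N : nat) : finType :=
  ('I_d * (probe_seed * tpow probe_seed N))%type.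

Definition round (N : nat) (s : round_seed N) : dtree (pt d n) R :=
  probe s.1 s.2.1 (fun o =>
    if o is Some b then seek s.1 b s.2.2 else Leaf _ _ true).

Lemma outcomeE f i w s : (outcome f i w == Some s) =
  viol <%R s (w.1 i) (hop_to (w.1 i) w.2) (f w.1) (f (probe_end i w)).
Proof.
rewrite /outcome /orientation; case: (boolP (viol _ true _ _ _ _)) => [vt|vf].
  case: s => //; apply/esym/negbTE; move: vt; rewrite /viol /=.
  case: ltngtP => //= _; rewrite ?orbF => /ltW le; rewrite -leNgt //.
case: s; first by rewrite (negbTE vf); case: ifP.
by case: ifP.
Qed.

Lemma unate_line f (dir : 'I_d -> bool) i :
  (forall x y, succ_at i x y -> if dir i then f x <= f y else f y <= f x) ->
  forall (x : pt d n) (z : 'I_n), (x i < z)%N ->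
    if dir i then f x <= f (upd x i z) else f (upd x i z) <= f x.
Proof.
move=> step x [z lt_zn] /=; elim: z lt_zn => // z IH lt_zn.
have lt' : (z < n)%N by apply: ltnW.
have {}step := step (upd x i (Ordinal lt')) (upd x i (Ordinal lt_zn)).
have : succ_at i (upd x i (Ordinal lt')) (upd x i (Ordinal lt_zn)).
  rewrite /succ_at !upd_at eqxx /=; apply/forallP => j; apply/implyP => ne.
  by rewrite !upd_other.
move/step; rewrite ltnS leq_eqVlt => le /orP [/eqP e|/IH].
  suff e' : upd x i (Ordinal lt') = x by rewrite e' in le.
  by rewrite -[RHS](upd_id x i); congr upd; apply: val_inj.
move=> /(_ lt'); case: (dir i) le => [le2 le1|le2 le1].
  exact: le_trans le1 le2.
exact: le_trans le2 le1.
Qed.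

(** All violated pairs of dimension [i] thus have orientation [~~ dir i], and no round can see two
    different ones. *)
Lemma unate_outcome f (dir : 'I_d -> bool) i w :
  (forall x y, succ_at i x y -> if dir i then f x <= f y else f y <= f x) ->
  outcome f i w != Some (dir i).
Proof.
move/unate_line => line; rewrite outcomeE /viol /probe_end.
set x := w.1; set z := hop_to _ _.
have fwd := line x z; have := line (upd x i z) (x i).
rewrite upd_at upd_upd upd_id /ltd; move: fwd.
case: (dir i) => fwd bwd; apply/norP; split; apply/negP => /andP [lt];
  by rewrite ltNge ?(fwd lt) ?(bwd lt).
Qed.

Lemma run_probe f i w k : run (probe i w k) f = run (k (outcome f i w)) f.
Proof. by []. Qed.

Lemma seek_unate f (dir : 'I_d -> bool) i N (ws : tpow probe_seed N) :
  (forall x y, succ_at i x y -> if dir i then f x <= f y else f y <= f x) ->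
  run (seek i (~~ dir i) ws) f.
Proof.
move=> step; elim: N ws => [|N IH] //= ws; rewrite -/(outcome f i ws.1).
have := unate_outcome ws.1 step; case: (outcome f i ws.1) => [s|] //=.
by case: s; case: (dir i).
Qed.

Lemma round_unate f N (s : round_seed N) : unate f -> run (round s) f.
Proof.
case: s => i [w ws] [dir step]; rewrite /round run_probe /=.
have := unate_outcome w (step i); case e : (outcome f i w) => [b|] //= ne.
have -> : b = ~~ dir i by case: (b) (dir i) ne => -[].
exact: seek_unate (step i).
Qed.

Section Probabilities.

Variables (f : pt d n -> R) (i : 'I_d).
Hypothesis n_gt0 : (0 < n)%N.

Definition hit (s : bool) : R := avg (fun w => (outcome f i w == Some s)%:R).

Lemma probe_seed_gt0 : (0 < #|probe_seed|)%N.
Proof.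
rewrite card_prod muln_gt0 card_ffun !card_ord expn_gt0 n_gt0 /=.
by rewrite card_prod card_ord card_bool.
Qed.

Lemma hit_ge0 s : 0 <= hit s.
Proof. by apply: avg_ge0 => w; rewrite ler0n. Qed.

Lemma hitE s : hit s = (dim_viol f i s)%:R / #|probe_seed|%:R.
Proof.
rewrite /hit /avg; congr (_ / _); rewrite -natr_sum /dim_viol exchange_big /=.
by rewrite pair_bigA; congr _%:R; apply: eq_bigr => w _; rewrite outcomeE.
Qed.

Lemma avg_outcome (F : option bool -> R) :
  avg (fun w => F (outcome f i w)) =
  hit true * F (Some true) + hit false * F (Some false) +
  (1 - hit true - hit false) * F None.
Proof.
pose I s w : R := (outcome f i w == Some s)%:R.
rewrite (eq_avg (G := fun w => F None + ((F (Some true) - F None) * I true w +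
   (F (Some false) - F None) * I false w))); last first.
  by move=> w; rewrite /I; case: (outcome f i w) => [[]|] /=; ring.
by rewrite !avgD !avgZ avg_const ?probe_seed_gt0 // -/(hit _) -/(hit _); ring.
Qed.

Lemma hit_le1 : hit true + hit false <= 1.
Proof.
have : 0 <= avg (fun w => (outcome f i w == None)%:R : R).
  by apply: avg_ge0 => w; rewrite ler0n.
by rewrite (avg_outcome (fun o => (o == None)%:R)) /=; lra.
Qed.

Let p := hit true + hit false.

Definition seek_rej (s : bool) N : R :=
  avg (fun ws : tpow probe_seed N => (~~ run (seek i s ws) f)%:R).

Definition seek_cost (s : bool) N : R :=
  avg (fun ws : tpow probe_seed N => (cost (seek i s ws) f)%:R).

(** Splitting off the first probe gives the recursion [hit (~~ s) + (1 - p) * seek_rej s N]. The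
    factor [p] on the left avoids a division and covers [p = 0]. *)
Lemma seek_rejE s N : p * seek_rej s N = hit (~~ s) * (1 - (1 - p) ^+ N).
Proof.
elim: N => [|N IH].
  by rewrite /seek_rej avg_const ?card_unit // expr0 subrr !mulr0.
have -> : seek_rej s N.+1 = hit (~~ s) + (1 - p) * seek_rej s N.
  rewrite {1}/seek_rej avg_pair.
  pose F (o : option bool) : R := if o is Some s' then (s' != s)%:R else seek_rej s N.
  rewrite (eq_avg (G := fun w => F (outcome f i w))).
    by rewrite (avg_outcome F) /F /p; case: (s) => /=; ring.
  move=> w /=; rewrite -/(outcome f i w); case: (outcome f i w) => [s'|] //=.
  by rewrite avg_const // tpow_gt0 // probe_seed_gt0.
have -> : p * (hit (~~ s) + (1 - p) * seek_rej s N) =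
    p * hit (~~ s) + (1 - p) * (p * seek_rej s N) by ring.
by rewrite IH exprS; ring.
Qed.

(** Each probe costs two queries, and the number of probes is geometric, cut off at [N]. *)
Lemma seek_costE s N : p * seek_cost s N = 2 * (1 - (1 - p) ^+ N).
Proof.
elim: N => [|N IH].
  by rewrite /seek_cost avg_const ?card_unit // expr0 subrr !mulr0.
have -> : seek_cost s N.+1 = 2 + (1 - p) * seek_cost s N.
  rewrite {1}/seek_cost avg_pair.
  pose F (o : option bool) : R := if o is Some s' then 2 else 2 + seek_cost s N.
  rewrite (eq_avg (G := fun w => F (outcome f i w))).
    by rewrite (avg_outcome F) /F /p; ring.
  move=> w /=; rewrite -/(outcome f i w); case: (outcome f i w) => [s'|] //=.
    by rewrite avg_const // tpow_gt0 // probe_seed_gt0.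
  rewrite (eq_avg (G := fun ws : tpow probe_seed N => 2 + (cost (seek i s ws) f)%:R)).
    by rewrite avgD avg_const // tpow_gt0 // probe_seed_gt0.
  by move=> ws; rewrite -natrD.
have -> : p * (2 + (1 - p) * seek_cost s N) =
    p * 2 + (1 - p) * (p * seek_cost s N) by ring.
by rewrite IH exprS; ring.
Qed.

Definition round_at N (s : probe_seed * tpow probe_seed N) := round (i, s).

(** Two queries for the first probe and, with probability [p], a search of expected cost at most
    [2 / p]. *)
Lemma round_cost N :
  avg (fun s : probe_seed * tpow probe_seed N => (cost (round_at s) f)%:R : R) <= 4.
Proof.
rewrite avg_pair.
pose F (o : option bool) : R := if o is Some s then 2 + seek_cost s N else 2.
rewrite (eq_avg (G := fun w => F (outcome f i w))); last first.
  move=> w; rewrite (eq_avg (G := fun ws => (cost (if outcome f i w is Some b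
    then seek i b ws else Leaf _ _ true) f).+2%:R)) // /F.
  case: (outcome f i w) => [s|] /=; last first.
    by rewrite avg_const // tpow_gt0 // probe_seed_gt0.
  rewrite (eq_avg (G := fun ws : tpow probe_seed N => 2 + (cost (seek i s ws) f)%:R)).
    by rewrite avgD avg_const // tpow_gt0 // probe_seed_gt0.
  by move=> ws; rewrite -natrD.
rewrite (avg_outcome F) /F.
have p1 : 0 <= 1 - p by rewrite subr_ge0 hit_le1.
have pw : 0 <= (1 - p) ^+ N by rewrite exprn_ge0.
have ct := seek_costE true N; have cf := seek_costE false N.
have eq_c : p * (hit true * seek_cost true N + hit false * seek_cost false N) =
   p * (2 * (1 - (1 - p) ^+ N)).
  have -> : p * (hit true * seek_cost true N + hit false * seek_cost false N) =
     hit true * (p * seek_cost true N) + hit false * (p * seek_cost false N) by ring.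
  by rewrite ct cf /p; ring.
have ht := hit_ge0 true; have hf := hit_ge0 false.
have [p0|p0] := eqVneq p 0.
  have -> : hit true = 0 by move: p0; rewrite /p; lra.
  have -> : hit false = 0 by move: p0; rewrite /p; lra.
  by lra.
have := mulfI p0 eq_c; rewrite /p in pw *; lra.
Qed.

(* Once a violation is seen, the next one is of the opposite orientation with
   probability [hit (~~ s) / p]; the product [2 * hit true * hit false / p] is at
   least the smaller hit probability. *)
Lemma round_rej N : (#|probe_seed| <= N)%N ->
  Num.min (hit true) (hit false) / 2 <=
  avg (fun s : probe_seed * tpow probe_seed N => (~~ run (round_at s) f)%:R : R).
Proof.
move=> le_N; rewrite avg_pair.
pose F (o : option bool) : R := if o is Some s then seek_rej s N else 0.
rewrite (eq_avg (G := fun w => F (outcome f i w))); last first.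
  move=> w; rewrite (eq_avg (G := fun ws => (~~ run (if outcome f i w is Some b
    then seek i b ws else Leaf _ _ true) f)%:R)) // /F.
  case: (outcome f i w) => [s|] //=.
  by rewrite avg_const // tpow_gt0 // probe_seed_gt0.
rewrite (avg_outcome F) /F mulr0 addr0.
have ht := hit_ge0 true; have hf := hit_ge0 false; have h1 := hit_le1.
have rt := seek_rejE true N; have rf := seek_rejE false N.
have p_ge0 : 0 <= p by rewrite addr_ge0.
have [p0|p0] := eqVneq p 0.
  have -> : hit true = 0 by move: p0; rewrite /p; lra.
  have -> : hit false = 0 by move: p0; rewrite /p; lra.
  by rewrite minxx; lra.
have p_gt0 : 0 < p by rewrite lt_def p0.
(* A nonzero [p] is at least the inverse of the number of probe seeds, so [N%:R * p >= 1] and the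
   Bernoulli bound gives 1/2. *)
have half : (1 - p) ^+ N <= 1 / 2.
  have Np : 1 <= N%:R * p.
    have eq_p : p = (dim_viol f i true + dim_viol f i false)%:R / #|probe_seed|%:R.
      by rewrite /p !hitE natrD mulrDl.
    have c0 : (0 : R) < #|probe_seed|%:R by rewrite ltr0n probe_seed_gt0.
    have v1 : (1 <= dim_viol f i true + dim_viol f i false)%N.
      by rewrite lt0n; apply: contra p0 => /eqP v0; rewrite eq_p v0 mul0r.
    rewrite eq_p mulrA ler_pdivlMr // mul1r -natrM ler_nat.
    by apply: leq_trans le_N _; rewrite leq_pmulr.
  have := bernoulli_inv N p_ge0 h1.
  have pw : 0 <= (1 - p) ^+ N by rewrite exprn_ge0 // subr_ge0.
  have : (1 - p) ^+ N * 2 <= (1 - p) ^+ N * (1 + N%:R * p).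
    by rewrite ler_wpM2l //; lra.
  by lra.
rewrite -(ler_pM2l p_gt0).
have -> : p * (hit true * seek_rej true N + hit false * seek_rej false N) =
   hit true * (p * seek_rej true N) + hit false * (p * seek_rej false N) by ring.
rewrite rt rf /=.
have -> : hit true * (hit false * (1 - (1 - p) ^+ N)) +
    hit false * (hit true * (1 - (1 - p) ^+ N)) =
    hit true * hit false * (2 * (1 - (1 - p) ^+ N)) by ring.
apply: (@le_trans _ _ (hit true * hit false)); last first.
  by rewrite ler_peMr ?(mulr_ge0 ht hf) //; lra.
rewrite /p; case: (leP (hit true) (hit false)) => [le|/ltW le].
  have : 0 <= hit true * (hit false - hit true) by rewrite mulr_ge0 ?subr_ge0.
  by lra.
have : 0 <= hit false * (hit true - hit false) by rewrite mulr_ge0 ?subr_ge0.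
by lra.
Qed.

End Probabilities.

End Round.

(** The bound [B] replaces the archimedean property of [R]. *)
Lemma bounded_ceil (R : realFieldType) (a : R) (B : nat) : 0 <= a -> a <= B%:R ->
  exists m : nat, a <= m%:R /\ m%:R <= a + 1.
Proof.
move=> a0 aB.
have ex_m : exists m : nat, a <= m%:R by exists B.
case: (ex_minnP ex_m) => -[|m] le_am min_m.
  by exists 0%N; split=> //; rewrite addr_ge0.
exists m.+1; split=> //; rewrite -natr1 lerD2r leNgt.
by apply/negP => /ltW /min_m; rewrite ltnn.
Qed.

Lemma avg_indicator (R : realFieldType) (S : finType) (P : pred S) :
  \sum_(s | P s) (#|S|%:R^-1 : R) = avg (fun s => (P s)%:R).
Proof.
rewrite /avg mulr_suml big_mkcond; apply: eq_bigr => s _.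
by case: (P s); rewrite ?mul1r ?mul0r.
Qed.

Lemma hop_card n : #|hop n| = ((trunc_log 2 n).+1 * 2)%N.
Proof. by rewrite card_prod card_ord card_bool. Qed.

(** * Assembling the tester *)

Section Tester.

Variables (R : realFieldType) (d n : nat).
Hypotheses (d_gt0 : (0 < d)%N) (n_gt0 : (0 < n)%N).

Let X := #|pt d n|.

Lemma pt_gt0 : (0 < X)%N.
Proof. by rewrite /X card_ffun !card_ord expn_gt0 n_gt0. Qed.

(* A positive distance is at least [X%:R^-1], and [X%:R^-1] bounds the number of
   rounds by a natural number even when [R] is not archimedean. *)
Lemma sum_min_hit (f : pt d n -> R) (eps : R) : 0 < eps -> eps_far f eps ->
  Num.max eps X%:R^-1 / (4 * #|hop n|%:R) <=
  \sum_i Num.min (hit f i true) (hit f i false).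
Proof.
move=> eps0 far.
pose dir i := (dim_viol f i true <= dim_viol f i false)%N.
have [g unate_g le_g] := dimension_reduction dir f.
have X0 : 0 < X%:R :> R by rewrite ltr0n pt_gt0.
have H0 : 0 < #|hop n|%:R :> R by rewrite ltr0n hop_card muln_gt0.
have far_g := far g unate_g.
have -> : \sum_i Num.min (hit f i true) (hit f i false) =
    (\sum_i dim_viol f i (dir i))%:R / (X%:R * #|hop n|%:R).
  rewrite natr_sum mulr_suml; apply: eq_bigr => i _.
  rewrite -natrM /X -card_prod !hitE /dir; set c := _^-1.
  have c0 : 0 <= c by rewrite invr_ge0 ler0n.
  case: leqP => le.
    by apply: min_l; rewrite ler_wpM2r // ler_nat.
  by apply: min_r; rewrite ler_wpM2r // ler_nat ltnW.
rewrite ler_pdivrMr ?mulr_gt0 //.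
have -> : (\sum_i dim_viol f i (dir i))%:R / (X%:R * #|hop n|%:R) * (4 * #|hop n|%:R)
    = (4 * \sum_i dim_viol f i (dir i))%:R / X%:R :> R.
  by rewrite natrM; field; rewrite !gt_eqF.
apply: (@le_trans _ _ (dist f g)); last first.
  by rewrite /dist ler_wpM2r ?invr_ge0 ?ler0n // ler_nat.
rewrite ge_max far_g /= /dist -/X -[X in X <= _]mul1r ler_wpM2r ?invr_ge0 ?ler0n //.
rewrite ler1n lt0n; apply/eqP => e0.
by move: far_g; rewrite /dist e0 mul0r leNgt eps0.
Qed.

Let N := #|probe_seed d n|.

Lemma round_seed_gt0 : (0 < #|round_seed d n N|)%N.
Proof.
have S0 := probe_seed_gt0 d n_gt0.
by rewrite card_prod card_ord muln_gt0 d_gt0 /= card_prod muln_gt0 S0 tpow_gt0.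
Qed.

Lemma avg_round_cost (f : pt d n -> R) :
  avg (fun s : round_seed d n N => (cost (round R s) f)%:R : R) <= 4.
Proof.
rewrite avg_pair -[X in _ <= X](@avg_const _ 'I_d) ?card_ord //.
by apply: ler_avg => i; apply: round_cost.
Qed.

(** A uniform dimension divides the sum in [sum_min_hit] by [d], and [round_rej] loses a factor 2,
    so 4 becomes 8. *)
Lemma avg_round_accept (f : pt d n -> R) (eps : R) : 0 < eps -> eps_far f eps ->
  avg (fun s : round_seed d n N => (run (round R s) f)%:R : R) <=
  1 - Num.max eps X%:R^-1 / (8 * d%:R * #|hop n|%:R).
Proof.
move=> eps0 far.
have d0 : 0 < d%:R :> R by rewrite ltr0n.
have H0 : 0 < #|hop n|%:R :> R by rewrite ltr0n hop_card muln_gt0.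
rewrite (eq_avg (G := fun s => 1 + (-1) * (~~ run (round R s) f)%:R)); last first.
  by move=> s; case: run => /=; ring.
rewrite avgD avgZ avg_const ?round_seed_gt0 // mulN1r lerD2l lerN2 avg_pair.
have -> : Num.max eps X%:R^-1 / (8 * d%:R * #|hop n|%:R) =
   Num.max eps X%:R^-1 / (4 * #|hop n|%:R) * (2 * d%:R)^-1.
  by field; rewrite !gt_eqF.
apply: (@le_trans _ _
    ((\sum_i Num.min (hit f i true) (hit f i false)) / (2 * d%:R))).
  rewrite ler_wpM2r ?invr_ge0 ?mulr_ge0 ?ler0n //; exact: sum_min_hit.
rewrite invfM mulrA mulr_suml -[X in _ / X%:R <= _](card_ord d).
by apply: ler_avg => i; apply: round_rej.
Qed.

Definition tester (m q : nat) : rtester R d n :=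
  @RTester R d n (tpow (round_seed d n N) m)
    (fun=> #|tpow (round_seed d n N) m|%:R^-1)
    (fun ss => trunc (rep (@round R d n N) ss) q).

Lemma tester_distribution m q : is_distribution (tester m q).
Proof.
split=> [s|] /=; first by rewrite invr_ge0 ler0n.
rewrite sumr_const -[_^-1 *+ _]mulr_natl mulfV // pnatr_eq0 -lt0n.
exact: tpow_gt0 round_seed_gt0.
Qed.

(** If a round accepts with probability [a], the choice of [m] gives [m%:R * (1 - a) >= 5], hence
    [a ^+ m <= 1 / 6] by Bernoulli. Expected cost [4 * m] against the budget [24 * m] adds a Markov
    error of 1/6. *)
Lemma tester_correct (eps : R) m : 0 < eps -> (0 < m)%N ->
  40 * d%:R * #|hop n|%:R / Num.max eps X%:R^-1 <= m%:R ->
  one_sided_unateness_tester eps (tester m (24 * m)).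
Proof.
move=> eps0 m0 le_m; split; [exact: tester_distribution|split].
  move=> f unate_f; have [_ <-] := tester_distribution m (24 * m).
  apply: eq_bigl => s /=; rewrite run_trunc rep_accepts ?orbT // => s'.
  exact: round_unate.
move=> f far; rewrite /prob_accept /= avg_indicator.
have q0 : (0 < 24 * m)%N by rewrite muln_gt0.
apply: le_trans (avg_run_trunc_rep round_seed_gt0 m q0 (avg_round_cost f)) _.
set a := avg _; set e := Num.max _ _ in le_m.
have e0 : 0 < e by rewrite lt_max eps0.
have d0 : 0 < d%:R :> R by rewrite ltr0n.
have H0 : 0 < #|hop n|%:R :> R by rewrite ltr0n hop_card muln_gt0.
have mR : 0 < m%:R :> R by rewrite ltr0n.
have a0 : 0 <= a by apply: avg_ge0 => s; rewrite ler0n.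
have le_a : a <= 1 - e / (8 * d%:R * #|hop n|%:R) by apply: avg_round_accept.
have mrho : 5 <= m%:R * (1 - a).
  apply: (@le_trans _ _ (m%:R * (e / (8 * d%:R * #|hop n|%:R)))); last first.
    by rewrite ler_wpM2l ?(ltW mR) //; lra.
  apply: (@le_trans _ _ (40 * d%:R * #|hop n|%:R / e * (e / (8 * d%:R * #|hop n|%:R)))).
    rewrite le_eqVlt; apply/orP; left; apply/eqP.
    by field; rewrite !gt_eqF.
  by rewrite ler_wpM2r // divr_ge0 ?mulr_ge0 // ltW.
have a1 : a <= 1 by apply: le_trans le_a _; rewrite gerBl divr_ge0 ?mulr_ge0 // ltW.
have := @bernoulli_inv _ (1 - a) m; rewrite subr_ge0 gerBl a0 a1 subKr.
move=> /(_ isT isT) bern.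
have am : a ^+ m <= 1 / 6.
  have : a ^+ m * 6 <= a ^+ m * (1 + m%:R * (1 - a)).
    by rewrite ler_wpM2l ?exprn_ge0 //; lra.
  by lra.
have -> : m%:R * 4 / (24 * m)%:R = 1 / 6 :> R.
  by rewrite natrM; field; rewrite gt_eqF.
by lra.
Qed.

End Tester.

(** * Degenerate grids and the final constant *)

Lemma trivial_tester (R : realFieldType) (d n : nat) (eps : R) : 0 < eps ->
  (forall f : pt d n -> R, unate f) ->
  exists T : rtester R d n,
    one_sided_unateness_tester eps T /\ query_complexity_le T 0.
Proof.
move=> eps0 all_unate.
exists (@RTester R d n unit (fun=> 1) (fun=> Leaf _ _ true)).
have sum1 : \sum_(s : unit) 1 = 1 :> R by rewrite sumr_const card_unit.
split; last by move=> s; apply: depth_leaf.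
split; [by split=> // s; rewrite ler01 | split=> // f far].
(* A unate [f] is at distance 0 from itself, so no function is far. *)
have := far f (all_unate f); rewrite /dist eq_card0 ?mul0r ?leNgt ?eps0 // => x.
by rewrite inE eqxx.
Qed.

Theorem theorem1 :
  exists C : nat, (0 < C)%N /\
  forall (R : realFieldType) (n d : nat) (eps : R),
    0 < eps -> eps < 1 / 2%:R ->
    exists (T : rtester R d n) (q : nat),
      one_sided_unateness_tester eps T /\
      query_complexity_le T q /\
      q%:R <= C%:R * (d%:R * (trunc_log 2 (maxn d n))%:R) / eps.
Proof.
(* [3936 = 24 * 41 * 4]: the budget per round, 40 plus 1 for rounding [m] up, and the hop count
   [H <= 4 * L]. *)
exists 3936%N; split=> // R n d eps eps0 eps_half.
(* For [d = 0] or [n <= 1] there are no neighbours and the claimed bound may be 0, so no query is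
   spent. *)
have [d0|d_gt0] := posnP d.
  have [f|T [T1 T2]] := @trivial_tester R d n eps eps0.
    by exists (fun=> true) => i; have := ltn_ord i; rewrite [X in (_ < X)%N]d0.
  by exists T, 0%N; split=> //; split=> //; rewrite divr_ge0 ?mulr_ge0 ?ler0n // ltW.
have [n1|n_gt1] := leqP n 1.
  have [f|T [T1 T2]] := @trivial_tester R d n eps eps0.
    exists (fun=> true) => i x y /andP [/eqP e _].
    by have := ltn_ord (y i); rewrite e => /leq_trans /(_ n1).
  by exists T, 0%N; split=> //; split=> //; rewrite divr_ge0 ?mulr_ge0 ?ler0n // ltW.
have n_gt0 : (0 < n)%N by apply: ltnW.
set L := trunc_log 2 n; set L' := trunc_log 2 (maxn d n).
have L_gt0 : (0 < L)%N by rewrite trunc_log_gt0.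
have le_L : (L <= L')%N by apply: leq_trunc_log; apply: leq_maxr.
have X0 : 0 < #|pt d n|%:R :> R by rewrite ltr0n pt_gt0.
have X1 : 1 <= #|pt d n|%:R :> R by rewrite ler1n pt_gt0.
pose e := Num.max eps #|pt d n|%:R^-1.
have e_gt0 : 0 < e by rewrite lt_max eps0.
have e_le1 : e <= 1 by rewrite ge_max invf_le1 // X1 andbT; lra.
have eps_e : eps <= e by rewrite le_max lexx.
have X_e : e^-1 <= #|pt d n|%:R.
  by rewrite -[X in _ <= X]invrK lef_pV2 ?posrE ?invr_gt0 // le_max lexx orbT.
set H := #|hop n|.
(* Here [H = 2 * (L + 1)], and [n >= 2] makes [L] positive. *)
have H_le : (H <= 4 * L)%N by rewrite /H hop_card -/L; lia.
have H_gt0 : (0 < H)%N by rewrite /H hop_card muln_gt0.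
have a_ge1 : 1 <= d%:R * H%:R / e.
  rewrite ler_pdivlMr // mul1r; apply: le_trans e_le1 _.
  by rewrite -natrM ler1n muln_gt0 d_gt0.
have [m [m_ge m_le]] : exists m : nat, 40 * d%:R * H%:R / e <= m%:R /\
    m%:R <= 40 * d%:R * H%:R / e + 1.
  apply: (@bounded_ceil _ _ (40 * d * H * #|pt d n|)); first by lra.
  by rewrite !natrM ler_wpM2l // !mulr_ge0 ?ler0n.
have m_gt0 : (0 < m)%N.
  by rewrite -(ltr0n R); apply: lt_le_trans m_ge; lra.
exists (tester R d n m (24 * m)), (24 * m)%N.
split; first exact: tester_correct.
split; first by move=> s; apply: depth_trunc.
apply: (@le_trans _ _ (984 * (d%:R * H%:R / e))); first by rewrite natrM; lra.
apply: (@le_trans _ _ (984 * (d%:R * H%:R / eps))).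
  rewrite ler_wpM2l // ler_wpM2l ?mulr_ge0 ?ler0n //.
  by rewrite lef_pV2 ?posrE.
rewrite mulrA ler_wpM2r ?invr_ge0 ?(ltW eps0) //.
rewrite -!natrM ler_nat mulnCA [leqRHS]mulnCA leq_mul2l; apply/orP; right.
by lia.
Qed.
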